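(* Let $p_1,p_2$ be distinct primes and $K=\mathbb{Q}(\sqrt{p_1},\sqrt{p_2})$. Let $K_1=\mathbb{Q}(\sqrt{p_1})$, $K_2=\mathbb{Q}(\sqrt{p_2})$, $K_3=\mathbb{Q}(\sqrt{p_1p_2})$, let $\epsilon_i$ be a fundamental unit of $K_i$ and $e_i=\mathrm{Nm}_{K_i/\mathbb{Q}}(\epsilon_i)$ for $i=1,2,3$. Suppose either (1) $p_1\equiv 1\pmod 4$, $p_2\not\equiv 3\pmod 4$, $e_1=e_2=-1$ and $e_3=1$; or (2) $p_1\equiv 3\pmod 4$ and $p_2=2$. Then the log-unit lattice of $K$ is orthogonal.
   Context: For a totally real number field $F$ of degree $n$ with real embeddings $\phi_1,\dots,\phi_n$, define $\mathrm{Log}:F^\times\to\mathbb{R}^n$ by $\mathrm{Log}(x)=(\log|\phi_1(x)|,\dots,\log|\phi_n(x)|)$. The log-unit lattice of $F$ is $\Lambda_F=\mathrm{Log}(\mathcal{O}_F^\times)$, a lattice in $\mathbb{R}^n$ (of rank $n-1$). A fundamental unit of a real quadratic field $F$ is a unit $\epsilon$ with $\mathrm{Log}(\epsilon)$ a basis of $\Lambda_F$. A lattice in $\mathbb{R}^n$ is called orthogonal if it has a basis of pairwise orthogonal vectors with respect to the standard Euclidean inner product. *)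

(* Defs.v *)
From HB Require Import structures.
From mathcomp Require Import all_boot all_order all_algebra all_field.
From mathcomp Require Import all_classical all_reals all_analysis.

Set Implicit Arguments.
Unset Strict Implicit.
Unset Printing Implicit Defensive.

Import Order.TTheory GRing.Theory Num.Theory.

Local Open Scope classical_set_scope.
Local Open Scope ring_scope.

Definition ring_of_integers (F : fieldExtType rat) : set F :=
  [set x | integralOver (intr : int -> F) x].

Definition integer_units (F : fieldExtType rat) : set F :=
  [set x | ring_of_integers x /\
           exists2 y, ring_of_integers y & x * y = 1].

(* An enumeration of [F : Q] distinct real embeddings, hence of all embeddings
   of F; such an enumeration exists if and only if F is totally real. *)
Record real_embeddings (R : realType) (F : fieldExtType rat) := RealEmbeddings {
  real_embedding :> 'I_(\dim {:F}) -> {rmorphism F -> R};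
  real_embedding_inj : forall i j,
    real_embedding i =1 real_embedding j -> i = j }.

(* Meaningful for x != 0 only, since ln 0 = 0 by convention. *)
Definition Log (R : realType) (F : fieldExtType rat)
    (phi : real_embeddings R F) (x : F) : 'rV[R]_(\dim {:F}) :=
  \row_i ln `|phi i x|.

Definition log_unit_lattice (R : realType) (F : fieldExtType rat)
    (phi : real_embeddings R F) : set 'rV[R]_(\dim {:F}) :=
  Log phi @` @integer_units F.

(* The basis vectors are the rows of b. *)
Definition lattice_basis (R : realType) (n r : nat)
    (L : set 'rV[R]_n) (b : 'M[R]_(r, n)) : Prop :=
  row_free b /\ L = [set map_mx intr c *m b | c in [set: 'rV[int]_r]].

Definition dot (R : realType) (n : nat) (u v : 'rV[R]_n) : R :=
  \sum_k u 0 k * v 0 k.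

Definition orthogonal_lattice (R : realType) (n : nat)
    (L : set 'rV[R]_n) : Prop :=
  exists (r : nat) (b : 'M[R]_(r, n)), lattice_basis L b /\
    forall i j, i != j -> dot (row i b) (row j b) = 0.

Definition fundamental_unit (R : realType) (F : fieldExtType rat)
    (phi : real_embeddings R F) (e : F) : Prop :=
  integer_units e /\ lattice_basis (log_unit_lattice phi) (Log phi e).

Definition rat_adjoin (K : fieldExtType rat) (s : K) : {subfield K} :=
  <<1; s>>%AS.

(* The field norm E -> Q, as an element of the ambient K: the product of the
   conjugates is the norm because we only take E Galois (quadratic) over Q. *)
Definition norm_rat (K : splittingFieldType rat) (E : {subfield K})
    (x : subvs_of E) : K :=
  galNorm 1 E (vsval x).

(* Main.v *)
Require Import Defs.
From HB Require Import structures.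
From mathcomp Require Import all_boot all_order all_algebra all_fingroup all_field.
From mathcomp Require Import all_classical all_reals all_analysis.
From mathcomp Require Import zify ring lra.

(** Let [K_i] be the three quadratic subfields of [K], [sg_i] the automorphism
    of [K] over [K_i], and [N_i y = y * sg_i y].  For a unit [y] of [K] each
    [N_i y] is [+- eps_i ^ k_i], and the product of the three is [y ^ 2] times
    the absolute norm [N y], which also equals [e_i ^ k_i] for every [i].  Both
    hypotheses give [e_3 = 1], hence [N y = 1], and [k_i] is even whenever
    [e_i = -1].  If [e_i = 1], the identity
    [(1 + eps_i) ^ 2 = (trace eps_i + 2) * eps_i] and a factorisation of
    [trace eps_i ^ 2 - 4] show that [+- eps_i] is a square in [K].  So the
    log-unit lattice is spanned by the [Log eps_i] with [e_i = -1] and the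
    [Log eps_i / 2] with [e_i = 1], which are orthogonal because [sg_i] fixes
    [Log eps_i] and negates [Log eps_j] for [j <> i]. *)

Set Implicit Arguments.
Unset Strict Implicit.
Unset Printing Implicit Defensive.

Import Order.TTheory GRing.Theory Num.Theory.

(** * Traces of units of norm one *)

(** The root is [gcdn a v]: the gcd of [a ^ 2] and [v ^ 2 = a * b] is [a * gcdn a b = a], and taking
    gcds commutes with squaring. *)
Lemma coprime_mul_square_square (a b v : nat) :
  coprime a b -> (a * b = v ^ 2)%N -> exists r, a = (r ^ 2)%N.
Proof.
move=> cab abv; exists (gcdn a v).
transitivity (gcdn (a * a) (v * v)).
  by rewrite (mulnn v) -abv -muln_gcdr (eqP cab) muln1.
(* What remains is that gcd commutes with squaring: divide [a] and [v] by [g], and use that the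
   squares of the coprime cofactors are coprime. *)
rewrite -[RHS]mulnn; set g := gcdn a v.
have [a_0|a0] := posnP a; first by rewrite /g a_0 mul0n !gcd0n.
have g0 : (0 < g)%N by rewrite gcdn_gt0 a0.
have [a' Ea] : exists a', a = (a' * g)%N by apply/dvdnP; rewrite dvdn_gcdl.
have [v' Ev] : exists v', v = (v' * g)%N by apply/dvdnP; rewrite dvdn_gcdr.
have co : coprime a' v'.
  rewrite /coprime -(eqn_pmul2r g0) mul1n; apply/eqP.
  by rewrite muln_gcdl -Ea -Ev.
rewrite Ea Ev mulnACA [X in gcdn _ X]mulnACA -muln_gcdl.
suff -> : gcdn (a' * a') (v' * v') = 1%N by rewrite mul1n.
by apply/eqP; change (coprime (a' * a') (v' * v')); rewrite coprimeMl !coprimeMr co.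
Qed.

(** Divide [a] and [d] by their gcd. The cofactor [d'] is coprime to [a'], so it divides [b];
    cancelling it leaves a square written as a product of the coprime factors [a'] and [b']. *)
Lemma coprime_mul_square (a b d v : nat) :
  coprime a b -> (0 < d)%N -> (a * b = d * v ^ 2)%N ->
  exists r, a = (gcdn a d * r ^ 2)%N.
Proof.
move=> cab d0 E; have [g Eg] : exists g, gcdn a d = g by exists (gcdn a d).
have g0 : (0 < g)%N by rewrite -Eg gcdn_gt0 d0 orbT.
have [a' Ea] : exists a', a = (a' * g)%N by apply/dvdnP; rewrite -Eg dvdn_gcdl.
have [d' Ed] : exists d', d = (d' * g)%N by apply/dvdnP; rewrite -Eg dvdn_gcdr.
have co : coprime a' d'.
  by rewrite /coprime -(eqn_pmul2r g0) mul1n muln_gcdl -Ea -Ed Eg.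
have E' : (a' * b = d' * v ^ 2)%N.
  by apply/eqP; rewrite -(eqn_pmul2r g0) mulnAC -Ea E {1}Ed mulnAC.
have [b' Eb] : exists b', b = (b' * d')%N.
  by apply/dvdnP; rewrite -(@Gauss_dvdr d' a' b) 1?coprime_sym // E' dvdn_mulr.
have d'0 : (0 < d')%N by case: (d') Ed d0 => // ->.
have E2 : (a' * b' = v ^ 2)%N.
  by apply/eqP; rewrite -(eqn_pmul2r d'0) -mulnA -Eb E' mulnC.
have [|r Er] := coprime_mul_square_square _ E2.
  by move: cab; rewrite Ea Eb coprimeMl coprimeMr => /andP[/andP[]].
by exists r; rewrite Eg Ea Er mulnC.
Qed.

(** For odd [x] the square [x ^ 2] is coprime to 4, so 4 would divide [d]. *)
Lemma even_of_dvd4 (d x : nat) :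
  (d %% 4 != 0)%N -> (4 %| d * x ^ 2)%N -> exists y, x = (2 * y)%N.
Proof.
move=> d4 dx; exists x./2; rewrite mul2n.
suff : ~~ odd x by have := odd_double_half x; case: (odd x).
apply: contra d4 => x_odd; move: dx; rewrite Gauss_dvdl // coprimeXr //.
by rewrite (@coprimeXl 2 2) // coprime2n.
Qed.

(* The factors of [t ^ 2 - 4 = d * u ^ 2] become coprime after dividing out
   powers of 2. *)
Lemma trace_add2_square_class (d D t u : nat) :
  (d %% 4 != 0)%N -> (d %| D)%N -> (d %% 4 = 3 -> 2 * d %| D)%N ->
  (t ^ 2 = d * u ^ 2 + 4)%N ->
  exists g r, (g %| D)%N /\ (t + 2 = g * r ^ 2)%N.
Proof.
move=> d4 dD d3 E; have d0 : (0 < d)%N by case: (d) d4.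
have gD x : (gcdn x d %| D)%N by apply: dvdn_trans dD; rewrite dvdn_gcdr.
have [k Ek] : exists k, t = (k + 2)%N.
  exists (t - 2)%N; rewrite subnK //; case: t E => [|[|//]]; first by rewrite addn4.
  by rewrite addn4.
(* For odd [t] the factors [t + 2] and [k = t - 2] are odd and differ by 4, hence coprime. *)
case: (boolP (odd t)) => t_odd.
  have co : coprime (t + 2) k.
    have -> : (t + 2 = k + 2 ^ 2)%N by rewrite Ek -addnA.
    rewrite /coprime gcdnC gcdnDl -/(coprime _ _) coprimeXr // coprimen2.
    by move: t_odd; rewrite Ek oddD addbF.
  have [|r Er] := coprime_mul_square co d0 (v := u).
    by move: E; rewrite Ek -!mulnn; lia.
  by exists (gcdn (t + 2) d), r.
have [T ET] : exists T, t = (2 * T)%N.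
  by exists t./2; rewrite mul2n; have := odd_double_half t; rewrite (negPf t_odd).
have T0 : (0 < T)%N by rewrite -(@ltn_pmul2l 2) // -ET Ek addn2.
have [U EU] : exists U, u = (2 * U)%N.
  apply: even_of_dvd4 d4 _; apply/dvdnP; exists (T ^ 2 - 1)%N.
  by move: E; rewrite ET expnMn; lia.
have {}E : (T ^ 2 = d * U ^ 2 + 1)%N.
  by move: E; rewrite ET EU !expnMn; lia.
have [m Em] : exists m, T = (m + 1)%N by exists (T - 1)%N; rewrite subnK.
(* For even [T] the factors [T + 1] and [m = T - 1] are odd and differ by 2. Since
   [t + 2 = 2 * (T + 1)], a factor 2 enters [g]; it is allowed because [d * U ^ 2 = T ^ 2 - 1] with
   [U] odd forces [d] to be 3 modulo 4. *)
case: (boolP (odd T)) => T_odd; last first.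
  have co : coprime (T + 1) m.
    have -> : (T + 1 = m + 2)%N by rewrite Em -addnA.
    rewrite /coprime gcdnC gcdnDl -/(coprime _ _) coprimen2.
    by move: T_odd; rewrite Em oddD addbT negbK.
  have [|r Er] := coprime_mul_square co d0 (v := U).
    by move: E; rewrite Em -!mulnn; lia.
  exists (2 * gcdn (T + 1) d)%N, r; split; last by rewrite -mulnA -Er ET; lia.
  apply: dvdn_trans (d3 _); first by rewrite dvdn_pmul2l // dvdn_gcdr.
  have [S ES] : exists S, T = (2 * S)%N.
    by exists T./2; rewrite mul2n; have := odd_double_half T; rewrite (negPf T_odd).
  have [W EW] : exists W, U = (2 * W + 1)%N.
    exists U./2; rewrite mul2n addn1 -[LHS]odd_double_half.
    suff -> : odd U by [].
    have : odd (d * U ^ 2) by move: T_odd; rewrite -[odd T](oddX T 2) E oddD addbT negbK.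
    by rewrite oddM oddX => /andP[].
  move: E; rewrite ES EW -!mulnn => E.
  have : (d + 4 * (d * (W * W + W)) + 1 = 4 * (S * S))%N by lia.
  by move: (d * _)%N (S * S)%N => x y; lia.
(* For odd [T] both factors are even. Halving them gives the consecutive, hence coprime, numbers [A]
   and [A + 1], and [t + 2 = 4 * (A + 1)] only gains a square factor. *)
have [A EA] : exists A, m = (2 * A)%N.
  exists m./2; rewrite mul2n; have := odd_double_half m.
  by move: T_odd; rewrite Em oddD addbT => /negPf->.
have [V EV] : exists V, U = (2 * V)%N.
  apply: even_of_dvd4 d4 _; apply/dvdnP; exists ((A + 1) * A)%N.
  by move: E; rewrite Em EA -!mulnn; lia.
have co : coprime (A + 1) A by rewrite /coprime gcdnC gcdnDl gcdn1.
have [|r Er] := coprime_mul_square co d0 (v := V).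
  by move: E; rewrite Em EA EV -!mulnn; lia.
exists (gcdn (A + 1) d), (2 * r)%N; split=> //.
by rewrite expnMn mulnCA -Er ET Em EA; lia.
Qed.

(** Both [t] and [u] must be even, which reduces the equation to [T ^ 2 + 1 = 2 * p * U ^ 2]. There
    [T] and [U] are odd, so [p * U ^ 2] is 3 modulo 4 while half of [T ^ 2 + 1] is 1 modulo 4. *)
Lemma sum_square4_neq (p t u : nat) :
  (p %% 4 = 3)%N -> (t ^ 2 + 4 <> 2 * p * u ^ 2)%N.
Proof.
move=> p4 E.
have half x : exists y, x = (2 * y)%N \/ x = (2 * y + 1)%N.
  by exists x./2; have := odd_double_half x; case: (odd x); lia.
rewrite (divn_eq p 4) p4 in E; move: (p %/ 4) E => q.
have [T [->|->]] := half t; last by rewrite -!mulnn; lia.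
have [U [->|->]] := half u; last by rewrite -!mulnn; lia.
have [S [->|->]] := half T; first by rewrite -!mulnn; lia.
have [W [->|->]] := half U; first by rewrite -!mulnn; lia.
(* The parity of [S] is split to expose that [S * (S + 1)] is even. *)
by have [Z [->|->]] := half S; rewrite -!mulnn; lia.
Qed.

(** * Squarefree numbers and integrality of rationals *)

Definition squarefree (d : nat) := forall n, (n ^ 2 %| d)%N -> n = 1%N.

Lemma squarefreeP (d : nat) : (0 < d)%N ->
  (forall q, prime q -> ~~ (q ^ 2 %| d)%N) -> squarefree d.
Proof.
move=> d0 H n nd; have n0 : (0 < n)%N by case: n nd; rewrite // dvd0n; case: (d) d0.
apply/eqP; rewrite eqn_leq n0 andbT leqNgt; apply/negP => n1.
have /negP := H _ (pdiv_prime n1); apply; apply: dvdn_trans nd.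
by rewrite dvdn_exp2r // pdiv_dvd.
Qed.

Lemma squarefree_prime (p : nat) : prime p -> squarefree p.
Proof.
move=> p_pr; apply: squarefreeP (prime_gt0 p_pr) _ => q q_pr; apply/negP=> qp.
have qp1 : (q %| p)%N by apply: dvdn_trans qp; rewrite dvdn_exp.
move: qp; rewrite -(eqP (etrans (esym (dvdn_prime2 q_pr p_pr)) qp1)).
by rewrite -{2}(expn1 q) dvdn_Pexp2l // prime_gt1.
Qed.

Lemma squarefree_prime2 (p q : nat) :
  prime p -> prime q -> p <> q -> squarefree (p * q).
Proof.
move=> p_pr q_pr pq; apply: squarefreeP; first by rewrite muln_gt0 !prime_gt0.
move=> r r_pr; apply/negP => rpq.
have : (r %| p * q)%N by apply: dvdn_trans rpq; rewrite dvdn_exp.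
rewrite Euclid_dvdM // => /orP[]; rewrite dvdn_prime2 // => /eqP Er.
  move: rpq; rewrite -Er -mulnn dvdn_pmul2l ?prime_gt0 // dvdn_prime2 //.
  by move/eqP=> rq; apply: pq; rewrite -Er.
move: rpq; rewrite -Er -mulnn dvdn_pmul2r ?prime_gt0 // dvdn_prime2 //.
by move/eqP=> rp; apply: pq; rewrite -rp.
Qed.

Local Open Scope ring_scope.

(** Clearing denominators, the square of the denominator of [w] divides [d] times the square of the
    numerator. Being coprime to the latter, it divides [d], so the denominator is 1. *)
Lemma squarefree_rat_int (d : nat) (w : rat) (m : int) : squarefree d ->
  d%:R * w ^+ 2 = m%:~R -> exists u : int, w = u%:~R.
Proof.
move=> sd E; exists (numq w).
suff dw : `|denq w|%N = 1%N.
  by rewrite -{1}(divq_num_den w) -absz_denq dw divr1.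
apply: sd; rewrite -(@Gauss_dvdl _ _ (`|numq w| ^ 2)); last first.
  by rewrite coprimeXr // coprimeXl // coprime_sym coprime_num_den.
have E' : (d%:Z * numq w ^+ 2 = m * denq w ^+ 2)%R.
  apply/(@intr_inj rat); rewrite [LHS]rmorphM [RHS]rmorphM /= !rmorphXn /=.
  by rewrite -E numqE exprMn mulrA.
move/(congr1 absz): E'; rewrite [LHS]abszM [RHS]abszM !abszX absz_nat => ->.
by rewrite dvdn_mull.
Qed.

Lemma squarefree_nonsquare (d : nat) (w : rat) :
  squarefree d -> d != 1%N -> w ^+ 2 != d%:R.
Proof.
move=> sd d1; apply/eqP => E.
(* With 1 as the squarefree coefficient, [w] is an integer [u]. Then [u ^ 2 = d] divides [d], which
   forces the absolute value of [u], and so [d], to be 1. *)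
have [||u Eu] := @squarefree_rat_int 1 w d.
  by move=> n; rewrite dvdn1 (eqn_exp2r _ 1) // => /eqP.
  by rewrite mul1r E -[RHS]pmulrn.
move: E; rewrite Eu -rmorphXn /= -[d%:R]/(d%:Z%:~R) => /intr_inj/(congr1 absz).
rewrite abszX => /= E; move/eqP: d1; apply.
by rewrite -E (sd `|u|%N) // E.
Qed.

(** The monic integer polynomial that kills [c] in [F] also kills its image in [algC], where a
    rational algebraic integer is an integer. *)
Lemma integral_rat_int (F : fieldExtType rat) (c : rat) :
  integralOver (intr : int -> F) c%:A -> exists m : int, c = m%:~R.
Proof.
case=> p p_mon pc0.
have : ratr c \in Aint.
  apply/(@root_monic_Aint (map_poly intr p)).
  - move: pc0; rewrite /root.
    have -> : map_poly intr p = map_poly (in_alg F) (map_poly intr p).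
      rewrite -map_poly_comp; apply: eq_map_poly => z /=.
      by rewrite -[RHS]/(in_alg F _) rmorph_int.
    rewrite -[c%:A]/(in_alg F c) horner_map fmorph_eq0 => pc0.
    have -> : map_poly intr p = map_poly (ratr : rat -> algC) (map_poly intr p).
      by rewrite -map_poly_comp; apply: eq_map_poly => z /=; rewrite ratr_int.
    by rewrite horner_map fmorph_eq0.
  - by rewrite monic_map.
  - by apply/polyOverP => i; rewrite coef_map /= intr_int.
move/(Cint_rat_Aint (Crat_rat c)) => /intrP[m Em]; exists m.
by apply: (fmorph_inj (ratr : {rmorphism rat -> algC})); rewrite /= Em ratr_int.
Qed.

(** * Quadratic extensions *)

(** The minimal polynomial of [s] divides X^2 - s^2, so the polynomial in [s] that represents [y]
    has degree at most 1. *)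
Lemma quadratic_adjoinP (F : fieldType) (L : fieldExtType F) (E : {subfield L})
    (s y : L) :
  s ^+ 2 \in E -> y \in <<E; s>>%VS ->
  exists A B, [/\ A \in E, B \in E & y = A + B * s].
Proof.
move=> s2E /Fadjoin_poly_eq Ey; set p := Fadjoin_poly E s y in Ey.
have pE : p \is a polyOver E := Fadjoin_polyOver E s y.
have szp : (size p <= 2)%N.
  apply: leq_trans (size_Fadjoin_poly _ _ _) _; rewrite -ltnS -size_minPoly.
  have P0 : 'X ^+ 2 - (s ^+ 2)%:P != 0 :> {poly L} by rewrite -size_poly_eq0 size_XnsubC.
  rewrite -(@size_XnsubC _ 2 (s ^+ 2)) //; apply: dvdp_leq P0 _.
  apply: minPoly_dvdp; first by rewrite rpredB ?rpredX ?polyOverX // polyOverC.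
  by rewrite /root !hornerE subrr.
exists p`_0, p`_1; split; try exact: (polyOverP pE).
by rewrite -Ey (horner_coef_wide _ szp) !big_ord_recl big_ord0 /= expr0 mulr1 expr1 addr0.
Qed.

Lemma minPoly_quadratic (F : fieldType) (L : fieldExtType F)
    (E : {subfield L}) (s : L) :
  s ^+ 2 \in E -> s \notin E -> minPoly E s = 'X ^+ 2 - (s ^+ 2)%:P.
Proof.
move=> s2E sE; apply/eqP; rewrite -eqp_monic ?monic_minPoly ?monicXnsubC //.
have dv : minPoly E s %| 'X ^+ 2 - (s ^+ 2)%:P.
  apply: minPoly_dvdp; first by rewrite rpredB ?rpredX ?polyOverX // polyOverC.
  by rewrite /root !hornerE subrr.
rewrite -dvdp_size_eqp // size_XnsubC // eqn_leq size_minPoly.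
have := dvdp_leq _ dv; rewrite -size_poly_eq0 size_XnsubC // size_minPoly => -> //=.
by move: sE; rewrite -adjoin_deg_eq1 /adjoin_degree; case: (_.-1).
Qed.

Lemma dim_quadratic_adjoin (F : fieldType) (L : fieldExtType F)
    (E : {subfield L}) (s : L) :
  s ^+ 2 \in E -> s \notin E -> \dim <<E; s>> = (2 * \dim E)%N.
Proof.
move=> s2E sE; rewrite dim_Fadjoin; congr (_ * _)%N; apply/succn_inj.
by rewrite -size_minPoly minPoly_quadratic // size_XnsubC.
Qed.

(** As [- s] is the other root of the minimal polynomial of [s], the identity of [E] extends to [L].
    The map is given both as a ring morphism, for calculations, and as a linear [kHom], for
    comparison with [galNorm]. *)
Lemma quadratic_conj (F : fieldType) (L : fieldExtType F)
    (E : {subfield L}) (s : L) :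
  s ^+ 2 \in E -> s \notin E -> <<E; s>>%VS = {:L}%VS ->
  exists sigma : {rmorphism L -> L},
    [/\ sigma s = - s, {in E, forall x, sigma x = x}
      & exists2 f : 'End(L), sigma =1 f & kHom 1 {:L} f].
Proof.
move=> s2E sE Es; pose f := kHomExtend E \1 s (- s).
have rt : root (map_poly \1%VF (minPoly E s)) (- s).
  have -> : map_poly \1%VF (minPoly E s) = minPoly E s.
    by apply/polyP => i; rewrite coef_map /= lfunE.
  by rewrite minPoly_quadratic // /root !hornerE sqrrN subrr.
have hE : kHom E E \1 := kHom1 E E.
have hf : kHom E {:L} f by rewrite -Es; apply: kHomExtendP.
have hf1 : kHom 1 {:L} f by apply: kHomSl hf; apply: sub1v.
have /kHom_monoid_morphism fM := hf1.
pose g := GRing.isMonoidMorphism.Build L L f fM.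
pose sigma : {rmorphism L -> L} := HB.pack (fun_of_lfun f) g.
exists sigma; split; last by exists f.
  by apply: (kHomExtend_val hE rt).
by move=> x Ex; rewrite -[sigma x]/(f x) /f kHomExtend_id // lfunE.
Qed.

Lemma galois_quadratic (F : fieldType) (L : splittingFieldType F) (s : L) :
  s ^+ 2 \in 1%VS -> s != - s -> galois 1 <<1; s>>.
Proof.
move=> s2 ss; apply/splitting_galoisField; exists ('X ^+ 2 - (s ^+ 2)%:P).
have Dp : 'X ^+ 2 - (s ^+ 2)%:P = \prod_(z <- [:: s; - s]) ('X - z%:P) :> {poly L}.
  by rewrite !big_cons big_nil mulr1 polyCN opprK -subr_sqr rmorphXn.
split; first by rewrite rpredB ?rpredX ?polyOverX // polyOverC.
  by rewrite Dp separable_prod_XsubC /= inE ss.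
exists [:: s; - s]; first by rewrite Dp eqpxx.
rewrite adjoin_cons adjoin_seq1; apply/(@Fadjoin_idP _ _ <<1; s>>%AS).
by rewrite rpredN memv_adjoin.
Qed.

(** The Galois group has order 2, the degree of the extension, so it consists of the identity and
    the restriction of [f], which moves [s]. *)
Lemma galNorm_quadratic (F : fieldType) (L : splittingFieldType F) (s : L)
    (f : 'End(L)) (x : L) :
  s ^+ 2 \in 1%VS -> s \notin 1%VS -> s != - s -> kHom 1 {:L} f -> f s = - s ->
  x \in <<1; s>>%VS -> galNorm 1 <<1; s>> x = x * f x.
Proof.
move=> s2 s1 ss hf fs xE; have gal := galois_quadratic s2 ss.
have /and3P[_ _ nE] := gal.
have hfE : kHom 1 <<1; s>> f by apply: kHomSr hf; apply: subvf.
have [|t tG ft] := kHom_to_gal _ nE hfE; first by rewrite subvv andbT sub1v.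
have t1 : (1%g : gal_of <<1; s>>) != t.
  by apply/eqP => t1; move: ss; rewrite -fs ft ?memv_adjoin // -t1 gal_id eqxx.
have GE : 'Gal(<<1; s>> / 1)%g = [set (1%g : gal_of <<1; s>>); t].
  apply/esym/eqP; rewrite eqEcard finset.subUset !finset.sub1set group1 tG /=.
  by rewrite -galois_dim // cards2 t1 dim_quadratic_adjoin // mulnK ?dimv1.
by rewrite /galNorm GE big_setU1 /= ?inE // big_set1 gal_id ft.
Qed.

(** * Integral units and logarithms *)

Lemma ring_of_integers_morph (K L : fieldExtType rat) (f : {rmorphism K -> L}) (x : K) :
  ring_of_integers x -> ring_of_integers (f x).
Proof.
case=> p p_mon px; exists p => //.
have -> : map_poly intr p = map_poly f (map_poly intr p).
  by rewrite -map_poly_comp; apply: eq_map_poly => z /=; rewrite rmorph_int.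
exact: rmorph_root.
Qed.

Lemma ring_of_integers_preim (K L : fieldExtType rat) (f : {rmorphism K -> L}) (x : K) :
  ring_of_integers (f x) -> ring_of_integers x.
Proof.
case=> p p_mon px; exists p => //; move: px.
have -> : map_poly intr p = map_poly f (map_poly intr p).
  by rewrite -map_poly_comp; apply: eq_map_poly => z /=; rewrite rmorph_int.
by rewrite fmorph_root.
Qed.

Lemma ring_of_integersM (K : fieldExtType rat) (x y : K) :
  ring_of_integers x -> ring_of_integers y -> ring_of_integers (x * y).
Proof. exact: (@integral_mul _ _ (intr : {rmorphism int -> K})). Qed.

Lemma ring_of_integersD (K : fieldExtType rat) (x y : K) :
  ring_of_integers x -> ring_of_integers y -> ring_of_integers (x + y).
Proof. exact: (@integral_add _ _ (intr : {rmorphism int -> K})). Qed.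

Lemma ring_of_integersN (K : fieldExtType rat) (x : K) :
  ring_of_integers x -> ring_of_integers (- x).
Proof. exact: (@integral_opp _ _ (intr : {rmorphism int -> K})). Qed.

Lemma integer_unitsE (K : fieldExtType rat) (x : K) :
  integer_units x <-> [/\ x != 0, ring_of_integers x & ring_of_integers x^-1].
Proof.
split=> [[xi [y yi xy]]|[x0 xi xVi]].
  have x0 : x != 0 by apply/eqP=> x0; move/eqP: xy; rewrite x0 mul0r eq_sym oner_eq0.
  by split=> //; have -> : x^-1 = y by rewrite -[y](mulKf x0) xy mulr1.
by split=> //; exists x^-1; rewrite ?divff.
Qed.

Lemma integer_units_neq0 (K : fieldExtType rat) (x : K) : integer_units x -> x != 0.
Proof. by case/integer_unitsE. Qed.

Lemma integer_unitsM (K : fieldExtType rat) (x y : K) :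
  integer_units x -> integer_units y -> integer_units (x * y).
Proof.
move=> /integer_unitsE[x0 xi xVi] /integer_unitsE[y0 yi yVi]; apply/integer_unitsE.
by split; rewrite ?mulf_neq0 // ?invfM; apply: ring_of_integersM.
Qed.

Lemma integer_unitsV (K : fieldExtType rat) (x : K) :
  integer_units x -> integer_units x^-1.
Proof.
move=> /integer_unitsE[x0 xi xVi]; apply/integer_unitsE.
by rewrite invr_eq0 invrK; split.
Qed.

Lemma integer_unitsN (K : fieldExtType rat) (x : K) :
  integer_units x -> integer_units (- x).
Proof.
move=> /integer_unitsE[x0 xi xVi]; apply/integer_unitsE.
by rewrite oppr_eq0 invrN; split=> //; apply: ring_of_integersN.
Qed.

Lemma integer_units1 (K : fieldExtType rat) : integer_units (1 : K).
Proof.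
apply/integer_unitsE; rewrite oner_eq0 invr1.
by split=> //; apply: (@integral1 _ _ (intr : {rmorphism int -> K})).
Qed.

Lemma integer_unitsX (K : fieldExtType rat) (x : K) (n : nat) :
  integer_units x -> integer_units (x ^+ n).
Proof.
move=> ux; elim: n => [|n IH]; first by rewrite expr0; apply: integer_units1.
by rewrite exprS; apply: integer_unitsM.
Qed.

Lemma integer_unitsXz (K : fieldExtType rat) (x : K) (k : int) :
  integer_units x -> integer_units (x ^ k).
Proof.
case: k => n ux; first exact: (integer_unitsX n ux).
exact: integer_unitsV (integer_unitsX n.+1 ux).
Qed.

Lemma integer_units_morph (K L : fieldExtType rat) (f : {rmorphism K -> L}) (x : K) :
  integer_units x -> integer_units (f x).
Proof.
move=> /integer_unitsE[x0 xi xVi]; apply/integer_unitsE.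
by rewrite fmorph_eq0 -fmorphV; split=> //; apply: ring_of_integers_morph.
Qed.

Lemma integer_units_preim (K L : fieldExtType rat) (f : {rmorphism K -> L}) (x : K) :
  integer_units (f x) -> integer_units x.
Proof.
move=> /integer_unitsE; rewrite fmorph_eq0 -fmorphV => -[x0 xi xVi].
by apply/integer_unitsE; split=> //; apply: (ring_of_integers_preim (f := f)).
Qed.

(** If a monic [p] kills [x ^ 2], then p(X^2) is monic and kills [x]. *)
Lemma ring_of_integers_sqrt (K : fieldExtType rat) (x : K) :
  ring_of_integers (x ^+ 2) -> ring_of_integers x.
Proof.
case=> p p_mon px; exists (p \Po 'X^2).
  rewrite monicE lead_coef_comp ?size_polyXn // (monicP p_mon).
  by rewrite lead_coefXn expr1n mulr1.
rewrite map_comp_poly /= map_polyXn.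
by rewrite /root horner_comp hornerXn.
Qed.

Lemma integer_units_sqrt (K : fieldExtType rat) (x : K) :
  integer_units (x ^+ 2) -> integer_units x.
Proof.
move=> /integer_unitsE; rewrite expf_eq0 /= -exprVn => -[x0 xi xVi].
by apply/integer_unitsE; split=> //; apply: ring_of_integers_sqrt.
Qed.

Lemma norm_integer_unit (K : fieldExtType rat) (x : K) (c : rat) :
  x = c%:A -> integer_units x -> x = 1 \/ x = - 1.
Proof.
move=> -> /integer_unitsE[c0 ci cVi]; move: cVi; rewrite -in_algE -fmorphV in_algE.
move=> /integral_rat_int[n En]; have [m Em] := integral_rat_int ci.
have : (m * n = 1)%R.
  apply/(@intr_inj rat); rewrite intrM -Em -En mulfV //.
  by apply: contraNneq c0 => ->; rewrite scale0r.
move/(congr1 absz); rewrite abszM => /eqP; rewrite muln_eq1 => /andP[m1 _].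
have [Em1|Em1] : m = 1 \/ m = -1 by lia.
  by left; rewrite Em Em1 scale1r.
by right; rewrite Em Em1 scaleN1r.
Qed.

Section Log.
Variables (R : realType) (K : fieldExtType rat) (phi : real_embeddings R K).

Lemma LogM (x y : K) : x != 0 -> y != 0 -> Log phi (x * y) = Log phi x + Log phi y.
Proof.
move=> x0 y0; apply/rowP => i; rewrite !mxE rmorphM normrM lnM //.
all: by rewrite posrE normr_gt0 fmorph_eq0.
Qed.

Lemma LogN (x : K) : Log phi (- x) = Log phi x.
Proof. by apply/rowP => i; rewrite !mxE rmorphN normrN. Qed.

Lemma Log1 : Log phi 1 = 0.
Proof. by apply/rowP => i; rewrite !mxE rmorph1 normr1 ln1. Qed.

Lemma LogV (x : K) : x != 0 -> Log phi x^-1 = - Log phi x.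
Proof.
by move=> x0; apply/eqP; rewrite -addr_eq0 addrC -LogM ?invr_eq0 // divff // Log1.
Qed.

Lemma LogX (x : K) (n : nat) : x != 0 -> Log phi (x ^+ n) = Log phi x *+ n.
Proof.
move=> x0; elim: n => [|n IH]; first by rewrite expr0 Log1 mulr0n.
by rewrite exprS LogM ?expf_neq0 // IH mulrS.
Qed.

Lemma LogXz (x : K) (k : int) : x != 0 -> Log phi (x ^ k) = Log phi x *~ k.
Proof.
case: k => n x0; first exact: LogX.
rewrite -[x ^ _]/((x ^+ n.+1)^-1) LogV ?expf_neq0 // LogX //.
Qed.

(** The lattice basis gives a [k] with [Log x] equal to [Log (e ^ k)]. One coordinate then suffices:
    a real embedding is injective, so an absolute value determines the element up to sign. *)
Lemma fundamental_unit_generates (e x : K) :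
  fundamental_unit phi e -> integer_units x ->
  exists k : int, x = e ^ k \/ x = - e ^ k.
Proof.
case=> /integer_units_neq0 e0 [_ EL] ux; have x0 := integer_units_neq0 ux.
have : log_unit_lattice phi (Log phi x) by exists x.
rewrite EL => -[c _ Ec]; exists (c 0 0).
pose i : 'I_(\dim {:K}) := Ordinal (adim_gt0 {:K}%AS).
have /eqP : ln `|phi i x| = ln `|phi i (e ^ c 0 0)|.
  have : Log phi x = Log phi (e ^ c 0 0).
    rewrite LogXz // -Ec (mx11_scalar c) map_scalar_mx mul_scalar_mx.
    by rewrite scaler_int mxE mulr1n.
  by move/rowP/(_ i); rewrite !mxE.
have pos z : z != 0 -> `|phi i z| \is Num.pos.
  by move=> z0; rewrite posrE normr_gt0 fmorph_eq0.
have ec0 : e ^ c 0 0 != 0 by rewrite expfz_neq0.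
move/eqP/(ln_inj (pos _ x0) (pos _ ec0))/eqP; rewrite eqr_norm2 -rmorphN.
by case/orP=> /eqP/fmorph_inj; [left|right].
Qed.

Lemma fundamental_unit_Log (e : K) : fundamental_unit phi e -> Log phi e != 0.
Proof.
case=> _ [fr _]; apply/eqP => E.
by move: fr; rewrite E /row_free mxrank0.
Qed.

End Log.

(** * Biquadratic fields *)

Lemma alg_natr (K : fieldExtType rat) (n : nat) : n%:R = (n%:R : rat)%:A :> K.
Proof. by rewrite scaler_nat. Qed.

Lemma sqrt_notin_rat (K : fieldExtType rat) (s : K) (d : nat) :
  squarefree d -> d != 1%N -> s ^+ 2 = d%:R -> s \notin 1%VS.
Proof.
move=> sd d1 s2; apply/negP => /vlineP[c sc].
move: s2; rewrite sc alg_natr exprZn expr1n => /(@fmorph_inj _ _ (in_alg K))/eqP.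
by rewrite (negPf (squarefree_nonsquare _ sd d1)).
Qed.

Lemma natr_eq0_fieldExt (K : fieldExtType rat) (n : nat) : (n%:R == 0 :> K) = (n == 0)%N.
Proof. by rewrite alg_natr -in_algE fmorph_eq0 pnatr_eq0. Qed.

Lemma oppr_neq (K : fieldExtType rat) (s : K) : s != 0 -> s != - s.
Proof. by rewrite -addr_eq0 -mulr2n -mulr_natl mulf_eq0 natr_eq0_fieldExt. Qed.

Lemma rat_adjoin_sqrtP (K : fieldExtType rat) (s x : K) (d : nat) :
  s ^+ 2 = d%:R -> x \in <<1; s>>%VS -> exists a b : rat, x = a%:A + b%:A * s.
Proof.
move=> s2 /quadratic_adjoinP[|A [B [/vlineP[a ->] /vlineP[b ->] ->]]].
  by rewrite s2 rpred_nat.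
by exists a, b.
Qed.

(** In [s2 = a + b * s1], the case [b = 0] makes [s2] rational, the case [a = 0] makes [s1 * s2]
    rational, and otherwise squaring makes [s1] rational. *)
Lemma sqrt_notin_quadratic (K : fieldExtType rat) (s1 s2 : K) (d1 d2 : nat) :
  s1 ^+ 2 = d1%:R -> s2 ^+ 2 = d2%:R -> squarefree d1 -> d1 != 1%N ->
  squarefree d2 -> d2 != 1%N ->
  squarefree (d1 * d2) -> (d1 * d2 != 1)%N -> s2 \notin <<1; s1>>%VS.
Proof.
move=> s1s s2s sd1 d1_1 sd2 d2_1 sd d_1; apply/negP => /(rat_adjoin_sqrtP s1s)[a [b Es]].
have n2 : s2 \notin 1%VS by apply: sqrt_notin_rat s2s.
have n12 : s1 * s2 \notin 1%VS.
  by apply: (sqrt_notin_rat sd d_1); rewrite exprMn s1s s2s natrM.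
have n1 : s1 \notin 1%VS by apply: sqrt_notin_rat s1s.
have ra c : c%:A \in (1%VS : {vspace K}) by apply: memvZ; apply: mem1v.
have [b0|b0] := eqVneq b 0.
  by move: n2; rewrite Es b0 scale0r mul0r addr0 ra.
have [a0|a0] := eqVneq a 0.
  move: n12; rewrite Es a0 scale0r add0r mulrCA -expr2 s1s alg_natr.
  by rewrite (@rpredM _ 1%AS) ?ra.
(* squaring [s2 = a + b s1] would make [s1] rational *)
have : s1 = ((d2%:R - a ^+ 2 - b ^+ 2 * d1%:R) / (2 * a * b))%:A.
  have ab : (2 * a * b)%:A != 0 :> K.
    by rewrite -in_algE fmorph_eq0 !mulf_neq0.
  apply: (mulIf ab); rewrite -!in_algE -[RHS]rmorphM divfK; last first.
    by rewrite !mulf_neq0.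
  rewrite !(rmorphXn, rmorphM, rmorphB, rmorph_nat) /= -s2s -s1s Es; ring.
by move=> E; move: n1; rewrite E ra.
Qed.

Lemma biquadratic_coord (K : fieldExtType rat) (s1 s2 : K) (d1 d2 : nat) (y : K) :
  s1 ^+ 2 = d1%:R -> s2 ^+ 2 = d2%:R -> <<<<1; s1>>; s2>>%VS = {:K}%VS ->
  exists a b c d : rat, y = a%:A + b%:A * s1 + (c%:A + d%:A * s1) * s2.
Proof.
move=> s1s s2s gen; have : y \in <<<<1; s1>>%AS; s2>>%VS by rewrite gen memvf.
case/quadratic_adjoinP=> [|A [B [/(rat_adjoin_sqrtP s1s)[a [b ->]]]]].
  by rewrite s2s rpred_nat.
by case/(rat_adjoin_sqrtP s1s)=> c [d ->] ->; exists a, b, c, d.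
Qed.

Lemma rmorph_alg_eq (K : fieldExtType rat) (L : unitRingType) (f g : {rmorphism K -> L})
    (c : rat) : f c%:A = g c%:A.
Proof.
by rewrite -in_algE -[LHS]/((f \o in_alg K) c) -[RHS]/((g \o in_alg K) c) !fmorph_eq_rat.
Qed.

Lemma biquadratic_ext (K : fieldExtType rat) (L : unitRingType)
    (s1 s2 : K) (d1 d2 : nat) (f g : {rmorphism K -> L}) :
  s1 ^+ 2 = d1%:R -> s2 ^+ 2 = d2%:R -> <<<<1; s1>>; s2>>%VS = {:K}%VS ->
  f s1 = g s1 -> f s2 = g s2 -> f =1 g.
Proof.
move=> s1s s2s gen fg1 fg2 y.
have [a [b [c [d ->]]]] := biquadratic_coord y s1s s2s gen.
by rewrite !(rmorphD, rmorphM) fg1 fg2 !(rmorph_alg_eq f g).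
Qed.

(** * Relative norms to the three quadratic subfields *)

Lemma norm_mem (K : fieldExtType rat) (E : {subfield K}) (sigma : {rmorphism K -> K})
    (r A B : K) :
  A \in E -> B \in E -> r ^+ 2 \in E -> {in E, forall x, sigma x = x} ->
  sigma r = - r -> (A + B * r) * sigma (A + B * r) \in E.
Proof.
move=> AE BE r2E sE sr; rewrite rmorphD rmorphM (sE _ AE) (sE _ BE) sr.
rewrite mulrN mulrC -subr_sqr exprMn.
by apply: rpredB; [apply: rpredX|apply: rpredM => //; apply: rpredX].
Qed.

Section Biquadratic.

Variables (K : fieldExtType rat) (s1 s2 : K) (d1 d2 : nat).
Hypotheses (s1s : s1 ^+ 2 = d1%:R) (s2s : s2 ^+ 2 = d2%:R).
Hypothesis gen : <<<<1; s1>>; s2>>%VS = {:K}%VS.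
Hypothesis d1_gt0 : (0 < d1)%N.
Variables (sg1 sg2 : {rmorphism K -> K}).
Hypotheses (sg1s1 : sg1 s1 = s1) (sg1s2 : sg1 s2 = - s2).
Hypotheses (sg2s1 : sg2 s1 = - s1) (sg2s2 : sg2 s2 = s2).

(** It negates both [s1] and [s2], hence fixes [s1 * s2]: this is the conjugation over the third
    quadratic subfield. *)
Let sg3 : {rmorphism K -> K} := sg1 \o sg2.

Let ext (f g : {rmorphism K -> K}) := @biquadratic_ext K K s1 s2 d1 d2 f g s1s s2s gen.

Lemma conj_commute : sg1 \o sg2 =1 sg2 \o sg1.
Proof. by apply: ext; rewrite /= ?(sg1s1, sg1s2, sg2s1, sg2s2, rmorphN). Qed.

Lemma conj1_involutive : sg1 \o sg1 =1 idfun.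
Proof. by apply: ext; rewrite /= ?(sg1s1, sg1s2, rmorphN, opprK). Qed.

Lemma conj2_involutive : sg2 \o sg2 =1 idfun.
Proof. by apply: ext; rewrite /= ?(sg2s1, sg2s2, rmorphN, opprK). Qed.

Lemma conj_fixed (s : K) (d : nat) (sigma : {rmorphism K -> K}) :
  s ^+ 2 = d%:R -> sigma s = s -> {in <<1; s>>%VS, forall x, sigma x = x}.
Proof.
move=> ss sigs x /(rat_adjoin_sqrtP ss)[a [b ->]].
by rewrite rmorphD rmorphM sigs !(rmorph_alg_eq sigma idfun).
Qed.

Lemma s12s : (s1 * s2) ^+ 2 = (d1 * d2)%:R.
Proof. by rewrite exprMn s1s s2s natrM. Qed.

Let adj (s : K) (a b : rat) : a%:A + b%:A * s \in <<1; s>>%VS.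
Proof.
have sE : s \in <<1; s>>%AS by apply: memv_adjoin.
have cE c : c%:A \in <<1; s>>%AS by apply: memvZ; apply: mem1v.
by rewrite rpredD ?rpredM ?cE.
Qed.

Lemma norm1_mem y : y * sg1 y \in <<1; s1>>%VS.
Proof.
have [a [b [c [d ->]]]] := biquadratic_coord y s1s s2s gen.
apply: (norm_mem (E := <<1; s1>>%AS)); rewrite ?adj //.
  by rewrite s2s rpred_nat.
exact: conj_fixed s1s sg1s1.
Qed.

Lemma norm2_mem y : y * sg2 y \in <<1; s2>>%VS.
Proof.
have [a [b [c [d ->]]]] := biquadratic_coord y s1s s2s gen.
have -> : a%:A + b%:A * s1 + (c%:A + d%:A * s1) * s2 =
          (a%:A + c%:A * s2) + (b%:A + d%:A * s2) * s1 by ring.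
apply: (norm_mem (E := <<1; s2>>%AS)); rewrite ?adj //.
  by rewrite s1s rpred_nat.
exact: conj_fixed s2s sg2s2.
Qed.

Lemma norm3_mem y : y * sg3 y \in <<1; s1 * s2>>%VS.
Proof.
have [a [b [c [d ->]]]] := biquadratic_coord y s1s s2s gen.
have d10 : d1%:R != 0 :> rat by rewrite pnatr_eq0 -lt0n.
(* This turns [c * s2] into [(c / d1) * (s1 * s2) * s1], so that [y] takes the form [A + B * s1]
   with [A] and [B] in the third subfield. *)
have Ec : c%:A = (c / d1%:R)%:A * s1 ^+ 2.
  by rewrite s1s alg_natr -!in_algE -rmorphM divfK.
have -> : a%:A + b%:A * s1 + (c%:A + d%:A * s1) * s2 =
          (a%:A + d%:A * (s1 * s2)) + (b%:A + (c / d1%:R)%:A * (s1 * s2)) * s1.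
  by rewrite Ec; ring.
apply: (norm_mem (E := <<1; s1 * s2>>%AS)); rewrite ?adj //.
- by rewrite s1s rpred_nat.
- apply: conj_fixed s12s _; rewrite /= rmorphM sg2s1 sg2s2 mulNr rmorphN.
  by rewrite rmorphM sg1s1 sg1s2 mulrN opprK.
- by rewrite /= sg2s1 rmorphN sg1s1.
Qed.

Let sgC z : sg1 (sg2 z) = sg2 (sg1 z). Proof. exact: conj_commute. Qed.
Let sg11 z : sg1 (sg1 z) = z. Proof. exact: conj1_involutive. Qed.

(* Each [n_i ^ k_i] is the absolute norm of [y]. *)
Lemma unit_square_decomp (e1 e2 e3 n1 n2 n3 y : K) :
  (forall z, integer_units z -> z \in <<1; s1>>%VS ->
    exists k : int, z = e1 ^ k \/ z = - e1 ^ k) ->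
  (forall z, integer_units z -> z \in <<1; s2>>%VS ->
    exists k : int, z = e2 ^ k \/ z = - e2 ^ k) ->
  (forall z, integer_units z -> z \in <<1; s1 * s2>>%VS ->
    exists k : int, z = e3 ^ k \/ z = - e3 ^ k) ->
  e1 * sg2 e1 = n1 -> e2 * sg1 e2 = n2 -> e3 * sg1 e3 = n3 ->
  e1 != 0 -> e2 != 0 -> e3 != 0 ->
  integer_units y ->
  exists (k1 k2 k3 : int), [/\ n1 ^ k1 = n3 ^ k3, n2 ^ k2 = n3 ^ k3 &
     n3 ^ k3 * y ^+ 2 = e1 ^ k1 * e2 ^ k2 * e3 ^ k3 \/
     n3 ^ k3 * y ^+ 2 = - (e1 ^ k1 * e2 ^ k2 * e3 ^ k3)].
Proof.
move=> H1 H2 H3 <- <- <- e10 e20 e30 uy.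
have um (f : {rmorphism K -> K}) : integer_units (y * f y).
  by apply: integer_unitsM => //; apply: integer_units_morph.
have [k1 E1] := H1 _ (um sg1) (norm1_mem y).
have [k2 E2] := H2 _ (um sg2) (norm2_mem y).
have [k3 E3] := H3 _ (um sg3) (norm3_mem y).
(* The sign in [x = e ^ k] or [x = - e ^ k] cancels in [x * f x]. For [x] a relative norm of [y]
   this product is the absolute norm of [y]. *)
have normX (e x : K) (k : int) (f : {rmorphism K -> K}) : e != 0 ->
    x = e ^ k \/ x = - e ^ k -> (e * f e) ^ k = x * f x.
  move=> e0 xe; rewrite expfzMl -fmorphXz.
  by case: xe => ->; rewrite ?rmorphN ?mulrNN.
exists k1, k2, k3; rewrite (normX _ _ _ sg2 e10 E1) (normX _ _ _ sg1 e20 E2).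
rewrite (normX _ _ _ sg1 e30 E3).
rewrite /= !rmorphM /= !sgC !sg11; split; [ring|ring|].
have -> : y * sg2 (sg1 y) * (sg1 y * sg2 y) * y ^+ 2 =
   (y * sg1 y) * (y * sg2 y) * (y * sg3 y) by rewrite /= sgC; ring.
case: E1 E2 E3 => -> [->|->] [->|->]; rewrite ?(mulrN, mulNr, opprK); by [left|right].
Qed.
End Biquadratic.

(** For [e = a + b * s] the trace [2 * a] is an integer [m], and [d * (2 * b) ^ 2 = m ^ 2 - 4 * n]
    is an integer too, so [2 * b] is one because [d] is squarefree. *)
Lemma trace_norm_coord (K : fieldExtType rat) (s e : K) (d : nat)
    (sigma : {rmorphism K -> K}) (n : int) :
  squarefree d -> s ^+ 2 = d%:R -> sigma s = - s -> e \in <<1; s>>%VS ->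
  ring_of_integers e -> e * sigma e = n%:~R ->
  exists m u : int, e + sigma e = m%:~R /\ m ^+ 2 = d%:R * u ^+ 2 + 4 * n.
Proof.
move=> sd ss sigs /(rat_adjoin_sqrtP ss)[a [b Ee]] ei en.
have sige : sigma e = a%:A - b%:A * s.
  by rewrite Ee rmorphD rmorphM sigs !(rmorph_alg_eq sigma idfun) mulrN.
have Et : e + sigma e = (2 * a)%:A.
  by rewrite sige Ee -!in_algE rmorphM rmorph_nat; ring.
have [m Em] : exists m : int, 2 * a = m%:~R.
  apply: (@integral_rat_int K); rewrite -Et.
  by apply: ring_of_integersD => //; apply: ring_of_integers_morph.
have E2 : d%:R * (2 * b) ^+ 2 = (m ^+ 2 - 4 * n)%:~R :> rat.
  rewrite rmorphB rmorphXn rmorphM /= -Em.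
  apply: (@fmorph_inj _ _ (in_alg K)).
  rewrite !(rmorphXn, rmorphM, rmorphB, rmorph_nat, rmorph_int) /= -ss -en sige Ee; ring.
have [u Eu] := squarefree_rat_int sd E2; exists m, u; split.
  by rewrite Et Em -in_algE rmorph_int.
apply: (@intr_inj rat); move: E2; rewrite Eu.
rewrite !(rmorphXn, rmorphM, rmorphB, rmorphD, rmorph_nat, rmorph_int) /= => E2.
by rewrite E2; ring.
Qed.

(* Hilbert 90 in the form [(1 + e) ^ 2 = (trace e + 2) * e] for a unit [e] of
   norm 1. *)
Lemma unit_norm1_sqrt (R : realFieldType) (K : fieldExtType rat)
    (phi : {rmorphism K -> R}) (s e : K) (d D : nat)
    (sigma : {rmorphism K -> K}) :
  squarefree d -> (d %% 4 != 0)%N -> (d %| D)%N -> (d %% 4 = 3 -> 2 * d %| D)%N ->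
  (forall g, (g %| D)%N -> exists r : K, r ^+ 2 = g%:R) ->
  s ^+ 2 = d%:R -> sigma s = - s -> e \in <<1; s>>%VS ->
  ring_of_integers e -> e * sigma e = 1 ->
  exists u, u ^+ 2 = e \/ u ^+ 2 = - e.
Proof.
move=> sd d4 dD d3 sqrtD ss sigs.
(* The norm does not see the sign of [x], so the positive case suffices. There the conjugate is
   positive as well, which makes the trace [m] positive and [m + 2] nonzero. *)
have pos x : 0 < phi x -> x \in <<1; s>>%VS -> ring_of_integers x ->
    x * sigma x = 1 -> exists u, u ^+ 2 = x.
  move=> x0 xs xi xn.
  have [m [u [Em Emu]]] := @trace_norm_coord _ _ _ _ _ 1 sd ss sigs xs xi xn.
  have sx0 : 0 < phi (sigma x).
    by rewrite -(pmulr_rgt0 _ x0) -rmorphM xn rmorph1.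
  have m0 : 0 < m by rewrite -(ltr0z R) -(rmorph_int phi) -Em rmorphD addr_gt0.
  have Emn : (`|m| ^ 2 = d * `|u| ^ 2 + 4)%N.
    apply/eqP; rewrite -eqz_nat PoszD PoszM -!abszX !gez0_abs ?sqr_ge0 //.
    by rewrite Emu mulr1 natz.
  have [g [r [gD Er]]] := trace_add2_square_class d4 dD d3 Emn.
  (* The square of [q * r%:R] is [g * r ^ 2 = m + 2], the factor by which [(1 + x) ^ 2] differs from
     [x]. *)
  have [q Eq] := sqrtD g gD; exists ((1 + x) / (q * r%:R)).
  have mK : m%:~R + 2 = (q * r%:R) ^+ 2 :> K.
    by rewrite exprMn Eq -natrX -natrM -Er natrD -[m]gez0_abs // ltW.
  rewrite expr_div_n -mK; apply: (canLR (mulfK _)); last first.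
    by rewrite -Em; ring: xn.
  by rewrite -(fmorph_eq0 phi) rmorphD rmorph_int rmorph_nat gt_eqF // addr_gt0 ?ltr0z.
move=> es ei en; have e0 : e != 0.
  by apply/eqP => e0; move/eqP: en; rewrite e0 mul0r eq_sym oner_eq0.
have [e_lt0|e_gt0|e_0] := ltgtP (phi e) 0; first 1 last.
- by have [u <-] := pos e e_gt0 es ei en; exists u; left.
- by move/eqP: e_0; rewrite fmorph_eq0 (negPf e0).
have [||||u <-] := pos (- e); last by exists u; right.
- by rewrite rmorphN oppr_gt0.
- by rewrite rpredN.
- exact: ring_of_integersN.
- by rewrite rmorphN mulrNN.
Qed.

(** * Embeddings and orthogonality *)

(* A real embedding is determined by the signs of the images of [s1] and [s2],
   so four distinct ones realise every sign pattern. *)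
Lemma biquadratic_embeddings_complete (R : realType) (K : fieldExtType rat)
    (phi : real_embeddings R K) (s1 s2 : K) (d1 d2 : nat) (psi : {rmorphism K -> R}) :
  s1 ^+ 2 = d1%:R -> s2 ^+ 2 = d2%:R -> <<<<1; s1>>; s2>>%VS = {:K}%VS ->
  \dim {:K} = 4%N -> exists k, phi k =1 psi.
Proof.
move=> s1s s2s gen dimK.
pose sgn (f : {rmorphism K -> R}) := (0 <= f s1, 0 <= f s2).
have sq (f g : {rmorphism K -> R}) s d : s ^+ 2 = d%:R ->
    (0 <= f s) = (0 <= g s) -> f s = g s.
  move=> ss fg; have : f s ^+ 2 = g s ^+ 2 by rewrite -!rmorphXn ss !rmorph_nat.
  move/eqP; rewrite eqf_sqr => /orP[/eqP//|/eqP E]; move: fg; rewrite E oppr_ge0.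
  by case: (ltgtP (g s) 0) => // ->; rewrite oppr0.
have sgn_eq f g : sgn f = sgn g -> f =1 g.
  by case=> E1 E2; apply: (biquadratic_ext s1s s2s gen);
    [apply: (sq _ _ _ _ s1s)|apply: (sq _ _ _ _ s2s)].
have inj : injective (fun k => sgn (phi k)).
  by move=> k l /sgn_eq; apply: real_embedding_inj.
have [|g _ gK] := inj_card_bij inj.
  by rewrite card_prod card_bool card_ord dimK.
by exists (g (sgn psi)); apply: sgn_eq; rewrite gK.
Qed.

(** Composition with [sigma] permutes the real embeddings, so it only reorders the terms of the
    inner product. *)
Lemma dot_Log_conj (R : realType) (K : fieldExtType rat)
    (phi : real_embeddings R K) (sigma : {rmorphism K -> K}) (x y : K) :
  (forall psi : {rmorphism K -> R}, exists k, phi k =1 psi) -> sigma \o sigma =1 idfun ->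
  dot (Log phi (sigma x)) (Log phi (sigma y)) = dot (Log phi x) (Log phi y).
Proof.
move=> all_phi sK.
have /choice[pi Hpi] : forall k, exists l, phi l =1 phi k \o sigma.
  by move=> k; apply: (all_phi (phi k \o sigma)).
have pi_inj : injective pi.
  move=> k l E; apply: (@real_embedding_inj _ _ phi) => z.
  have := Hpi k (sigma z); have := Hpi l (sigma z); rewrite E /= => -> .
  by have /= -> := sK z => ->.
rewrite /dot [RHS](reindex_inj pi_inj); apply: eq_bigr => k _.
by rewrite !mxE !Hpi.
Qed.

Lemma dotNr (R : realType) (n : nat) (u v : 'rV[R]_n) : dot u (- v) = - dot u v.
Proof. by rewrite /dot -sumrN; apply: eq_bigr => k _; rewrite mxE mulrN. Qed.

Lemma dotZl (R : realType) (n : nat) (a : R) (u v : 'rV[R]_n) :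
  dot (a *: u) v = a * dot u v.
Proof. by rewrite /dot mulr_sumr; apply: eq_bigr => k _; rewrite mxE mulrA. Qed.

Lemma dotC (R : realType) (n : nat) (u v : 'rV[R]_n) : dot u v = dot v u.
Proof. by apply: eq_bigr => k _; rewrite mulrC. Qed.

Lemma dot_suml (R : realType) (n r : nat) (c : 'I_r -> R)
    (u : 'I_r -> 'rV[R]_n) (v : 'rV[R]_n) :
  dot (\sum_i c i *: u i) v = \sum_i c i * dot (u i) v.
Proof.
rewrite /dot; under [RHS]eq_bigr do rewrite mulr_sumr.
rewrite exchange_big /=; apply: eq_bigr => k _.
by rewrite summxE mulr_suml; apply: eq_bigr => i _; rewrite mxE mulrA.
Qed.

Lemma dot_self_neq0 (R : realType) (n : nat) (u : 'rV[R]_n) : u != 0 -> dot u u != 0.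
Proof.
apply: contraNneq => /psumr_eq0P E; apply/eqP/rowP => k; rewrite mxE; apply/eqP.
by rewrite -sqrf_eq0 expr2 E // => i _; rewrite -expr2 sqr_ge0.
Qed.

(** Conjugation preserves the inner product and here also changes its sign. *)
Lemma dot_Log_conj_opp (R : realType) (K : fieldExtType rat)
    (phi : real_embeddings R K) (sigma : {rmorphism K -> K}) (x y : K) :
  (forall psi : {rmorphism K -> R}, exists k, phi k =1 psi) -> sigma \o sigma =1 idfun ->
  Log phi (sigma x) = Log phi x -> Log phi (sigma y) = - Log phi y ->
  dot (Log phi x) (Log phi y) = 0.
Proof.
move=> all_phi sK Ex Ey; have := dot_Log_conj x y all_phi sK.
by rewrite Ex Ey dotNr => E; lra.
Qed.

Lemma Log_conj_opp (R : realType) (K : fieldExtType rat)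
    (phi : real_embeddings R K) (sigma : {rmorphism K -> K}) (x : K) :
  x * sigma x = 1 \/ x * sigma x = -1 -> Log phi (sigma x) = - Log phi x.
Proof.
move=> xn; have x0 : x != 0.
  apply/eqP => x0; move: xn; rewrite x0 mul0r => -[] /eqP;
    by rewrite eq_sym ?oppr_eq0 oner_eq0.
apply/eqP; rewrite -addr_eq0 addrC -LogM ?fmorph_eq0 //.
by case: xn => ->; rewrite ?LogN Log1.
Qed.

(** Pairing a linear relation with row [i] leaves its [i]-th coefficient times a nonzero squared
    length. *)
Lemma orthogonal_row_free (R : realType) (n r : nat) (b : 'M[R]_(r, n)) :
  (forall i, row i b != 0) ->
  (forall i j, i != j -> dot (row i b) (row j b) = 0) -> row_free b.
Proof.
move=> b0 orth; rewrite -kermx_eq0; apply/eqP/row_matrixP => k; rewrite row0.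
have : row k (kermx b) *m b = 0 by rewrite -row_mul mulmx_ker row0.
move: (row k _) => c; rewrite mulmx_sum_row => E; apply/rowP => i; rewrite mxE.
have := congr1 (fun v => dot v (row i b)) E; rewrite /= dot_suml (bigD1 i) //= big1.
  rewrite addr0 => /eqP; rewrite [X in _ == X](_ : _ = 0); last first.
    by rewrite /dot big1 // => j _; rewrite mxE mul0r.
  by rewrite mulf_eq0 (negPf (dot_self_neq0 (b0 i))) orbF => /eqP.
by move=> j ji; rewrite orth // mulr0.
Qed.

(* [u] is [e] itself or a square root of [+-e]; in both cases the powers
   [e ^ k] that satisfy [n ^ k = 1] are squares of powers of [u] up to sign. *)
Lemma half_unit (R : realType) (K : fieldExtType rat)
    (phi : real_embeddings R K) (e n : K) :
  integer_units e -> n = -1 \/ (exists u, u ^+ 2 = e \/ u ^+ 2 = - e) ->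
  exists (u : K) (a : R), [/\ integer_units u, a != 0, Log phi u = a *: Log phi e
    & forall k : int, n ^ k = 1 -> exists m : int, Log phi e *~ k = Log phi u *~ m *+ 2].
Proof.
move=> ue [->|[u u2]].
  (* For [n = -1] take [u = e]: the condition [n ^ k = 1] says that [k] is even, and [m] is its
     half. *)
  exists e, 1; rewrite oner_neq0 scale1r; split=> // k nk.
  have [m Em] : exists m : int, k = m * 2.
    exists (k %/ 2)%Z; apply/eqP; rewrite eq_sym -dvdz_eq.
    case: k nk => k nk; rewrite dvdzE /= dvdn2; move: nk.
      rewrite -[_ ^ _]/((-1) ^+ k) -signr_odd; case: (odd k) => //.
      by move/eqP; rewrite expr1 eq_sym (negPf (oppr_neq _)) ?oner_eq0.
    rewrite -[_ ^ _]/(((-1) ^+ k.+1)^-1) -signr_odd; case: (odd k.+1) => //.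
    by move/eqP; rewrite expr1 invrN1 eq_sym (negPf (oppr_neq _)) ?oner_eq0.
  by exists m; rewrite Em mulrzA.
have uu : integer_units u.
  by apply: integer_units_sqrt; case: u2 => ->; [|apply: integer_unitsN].
have EL : Log phi e = Log phi u *+ 2.
  by rewrite -(LogX phi 2 (integer_units_neq0 uu)); case: u2 => ->; rewrite ?LogN.
(* Here [Log phi e] is twice [Log phi u], so [m = k] works for every [k]. *)
exists u, 2^-1; split=> [//|||].
- by rewrite invr_eq0 pnatr_eq0.
- by rewrite EL -[Log phi u *+ 2]scaler_nat scalerA mulVf ?pnatr_eq0 ?scale1r.
by move=> k _; exists k; rewrite EL !pmulrn mulrzAC.
Qed.

(** Orthogonality of nonzero vectors already gives independence, so only spanning has to be
    supplied; integer combinations are realised by products of powers of the units. *)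
Lemma orthogonal_log_unit_lattice (R : realType) (K : fieldExtType rat)
    (phi : real_embeddings R K) (r : nat) (u : 'I_r -> K) :
  (forall i, integer_units (u i)) -> (forall i, Log phi (u i) != 0) ->
  (forall i j, i != j -> dot (Log phi (u i)) (Log phi (u j)) = 0) ->
  (forall y, integer_units y ->
     exists m : 'I_r -> int, Log phi y = \sum_i Log phi (u i) *~ m i) ->
  orthogonal_lattice (log_unit_lattice phi).
Proof.
move=> uu u0 orth gen; pose b := \matrix_i Log phi (u i).
have bE i : row i b = Log phi (u i) by rewrite rowK.
have orthb i j : i != j -> dot (row i b) (row j b) = 0 by rewrite !bE; apply: orth.
exists r, b; split=> //; split.
  by apply: orthogonal_row_free => // i; rewrite bE.
have cb (c : 'rV[int]_r) : map_mx intr c *m b = \sum_i Log phi (u i) *~ c 0 i.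
  by rewrite mulmx_sum_row; apply: eq_bigr => i _; rewrite bE mxE scaler_int.
apply/seteqP; split=> [_ [y uy <-]|_ [c _ <-]].
  have [m ->] := gen y uy; exists (\row_i m i) => //.
  by rewrite cb; apply: eq_bigr => i _; rewrite mxE.
rewrite cb; exists (\prod_i u i ^ c 0 i).
  by apply: big_ind => [|x y|i _];
    [apply: integer_units1|apply: integer_unitsM|apply: integer_unitsXz].
(* Both facts go through one induction, since additivity of [Log] requires the partial products to
   be nonzero. *)
have [_ ->] : integer_units (\prod_i u i ^ c 0 i) /\
    Log phi (\prod_i u i ^ c 0 i) = \sum_i Log phi (u i) *~ c 0 i; last by [].
apply: (big_ind2 (fun x l => integer_units x /\ Log phi x = l)).
- by split; [apply: integer_units1|apply: Log1].
- move=> x l y l' [ux <-] [uy <-]; split; first exact: integer_unitsM.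
  by rewrite LogM // integer_units_neq0.
- by move=> i _; rewrite LogXz ?integer_units_neq0 //; split=> //; apply: integer_unitsXz.
Qed.

Lemma Log_eq0 (R : realType) (K : fieldExtType rat) (phi : real_embeddings R K) (x : K) :
  x != 0 -> Log phi x = 0 -> x = 1 \/ x = -1.
Proof.
move=> x0; pose i : 'I_(\dim {:K}) := Ordinal (adim_gt0 {:K}%AS).
move=> /rowP/(_ i); rewrite !mxE => /eqP; rewrite ln_eq0 ?normr_gt0 ?fmorph_eq0 //.
rewrite -[1]normr1 eqr_norm2 -(rmorph1 (phi i)) -rmorphN.
by case/orP=> /eqP/fmorph_inj; [left|right].
Qed.

(** * Units of the quadratic subfields viewed in the biquadratic field *)

Lemma subfield_fundamental_unit_generates (R : realType) (K : fieldExtType rat)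
    (E : {subfield K}) (psi : real_embeddings R (subvs_of E)) (e : subvs_of E) (z : K) :
  fundamental_unit psi e -> integer_units z -> z \in E ->
  exists k : int, z = vsval e ^ k \/ z = - vsval e ^ k.
Proof.
move=> fe uz zE; pose v : {rmorphism subvs_of E -> K} := vsval.
have uz' : integer_units (Subvs zE) by apply: (integer_units_preim (f := v)).
have [k Hk] := fundamental_unit_generates fe uz'; exists k.
rewrite -[vsval e ^ k](fmorphXz v) -rmorphN.
by case: Hk => /(congr1 v) Hk; [left|right].
Qed.

(** No relation between [phi] and [psi] is assumed, so the argument passes through elements: a zero
    logarithm in [K] forces [e] to be 1 or -1, whose logarithm under [psi] is zero too. *)
Lemma subfield_fundamental_unit_Log (R : realType) (K : fieldExtType rat)
    (E : {subfield K}) (phi : real_embeddings R K)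
    (psi : real_embeddings R (subvs_of E)) (e : subvs_of E) :
  fundamental_unit psi e -> Log phi (vsval e) != 0.
Proof.
move=> fe; pose v : {rmorphism subvs_of E -> K} := vsval.
have e0 := integer_units_neq0 (proj1 fe).
apply: contra_neq (fundamental_unit_Log fe) => /Log_eq0[|E1|E1].
- by rewrite -[vsval e]/(v e) fmorph_eq0.
- suff -> : e = 1 by rewrite Log1.
  by apply: (fmorph_inj v); rewrite rmorph1.
- suff -> : e = -1 by rewrite LogN Log1.
  by apply: (fmorph_inj v); rewrite rmorphN rmorph1.
Qed.

(** The product is the rational [a ^ 2 - b ^ 2 * d] and a unit. *)
Lemma quadratic_unit_norm (K : fieldExtType rat) (s e : K) (d : nat)
    (sigma : {rmorphism K -> K}) :
  s ^+ 2 = d%:R -> sigma s = - s -> e \in <<1; s>>%VS -> integer_units e ->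
  e * sigma e = 1 \/ e * sigma e = -1.
Proof.
move=> ss sigs /(rat_adjoin_sqrtP ss)[a [b Ee]] ue.
apply: (@norm_integer_unit _ _ (a ^+ 2 - b ^+ 2 * d%:R)); last first.
  by apply: integer_unitsM => //; apply: integer_units_morph.
rewrite Ee rmorphD rmorphM sigs !(rmorph_alg_eq sigma idfun) /=.
by rewrite -!in_algE !(rmorphXn, rmorphM, rmorphB, rmorph_nat) /= -ss; ring.
Qed.

(** * A criterion for orthogonality from norms and square roots of the quadratic units *)

Section Criterion.

Variables (R : realType) (K : fieldExtType rat) (phi : real_embeddings R K).
Variables (s1 s2 : K) (d1 d2 : nat).
Hypotheses (s1s : s1 ^+ 2 = d1%:R) (s2s : s2 ^+ 2 = d2%:R).
Hypothesis gen : <<<<1; s1>>; s2>>%VS = {:K}%VS.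
Hypothesis dimK : \dim {:K} = 4%N.
Hypothesis d1_gt0 : (0 < d1)%N.
Variables (sg1 sg2 : {rmorphism K -> K}).
Hypotheses (sg1s1 : sg1 s1 = s1) (sg1s2 : sg1 s2 = - s2).
Hypotheses (sg2s1 : sg2 s1 = - s1) (sg2s2 : sg2 s2 = s2).
Variables (e1 e2 e3 : K).
Hypotheses (e1E : e1 \in <<1; s1>>%VS) (e2E : e2 \in <<1; s2>>%VS)
  (e3E : e3 \in <<1; s1 * s2>>%VS).
Hypotheses (ue1 : integer_units e1) (ue2 : integer_units e2) (ue3 : integer_units e3).
Hypotheses (Le1 : Log phi e1 != 0) (Le2 : Log phi e2 != 0) (Le3 : Log phi e3 != 0).
Hypothesis gen1 : forall z, integer_units z -> z \in <<1; s1>>%VS ->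
  exists k : int, z = e1 ^ k \/ z = - e1 ^ k.
Hypothesis gen2 : forall z, integer_units z -> z \in <<1; s2>>%VS ->
  exists k : int, z = e2 ^ k \/ z = - e2 ^ k.
Hypothesis gen3 : forall z, integer_units z -> z \in <<1; s1 * s2>>%VS ->
  exists k : int, z = e3 ^ k \/ z = - e3 ^ k.

(** These conditions are common to both cases of the theorem; only the first unit may be of either
    kind. *)
Lemma orthogonal_criterion :
  e1 * sg2 e1 = -1 \/ (exists u, u ^+ 2 = e1 \/ u ^+ 2 = - e1) ->
  e2 * sg1 e2 = -1 ->
  e3 * sg1 e3 = 1 -> (exists u, u ^+ 2 = e3 \/ u ^+ 2 = - e3) ->
  orthogonal_lattice (log_unit_lattice phi).
Proof.
move=> h1 h2 h3 h4.
have [u1 [a1 [uu1 a10 L1 half1]]] := half_unit phi ue1 h1.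
have [u2 [a2 [uu2 a20 L2 half2]]] := half_unit phi ue2 (or_introl h2).
(* The type ascription fixes [n] as the norm of [e3], so that the condition on [k] becomes the
   trivial [1 ^ k = 1]. *)
have [u3 [a3 [uu3 a30 L3 half3]]] :=
  half_unit phi ue3 (or_intror h4 : e3 * sg1 e3 = -1 \/ _).
rewrite h2 in half2; rewrite h3 in half3.
have all_phi psi := biquadratic_embeddings_complete phi psi s1s s2s gen dimK.
have sg1K := conj1_involutive s1s s2s gen sg1s1 sg1s2.
have sg2K := conj2_involutive s1s s2s gen sg2s1 sg2s2.
have s12s := s12s s1s s2s.
have d12 : dot (Log phi e1) (Log phi e2) = 0.
  apply: (dot_Log_conj_opp all_phi sg1K); first by rewrite (conj_fixed s1s sg1s1).
  exact/Log_conj_opp/(quadratic_unit_norm s2s).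
have d13 : dot (Log phi e1) (Log phi e3) = 0.
  apply: (dot_Log_conj_opp all_phi sg1K); first by rewrite (conj_fixed s1s sg1s1).
  by apply: Log_conj_opp; left.
have d23 : dot (Log phi e2) (Log phi e3) = 0.
  apply: (dot_Log_conj_opp all_phi sg2K); first by rewrite (conj_fixed s2s sg2s2).
  apply/Log_conj_opp/(quadratic_unit_norm s12s) => //.
  by rewrite rmorphM sg2s1 sg2s2 mulNr.
have dotL (x y u v : K) (a c : R) : Log phi u = a *: Log phi x ->
    Log phi v = c *: Log phi y -> dot (Log phi x) (Log phi y) = 0 ->
    dot (Log phi u) (Log phi v) = 0.
  by move=> -> -> E; rewrite dotZl dotC dotZl dotC E !mulr0.
pose u (i : 'I_3) : K := [:: u1; u2; u3]`_i.
apply: (@orthogonal_log_unit_lattice _ _ phi 3 u).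
- by move=> [[|[|[|n]]] ltn].
- move=> [[|[|[|n]]] ltn] //; rewrite /u /= ?(L1, L2, L3) scaler_eq0 negb_or;
    by rewrite ?(a10, a20, a30).
- have D12 := dotL _ _ _ _ _ _ L1 L2 d12.
  have D13 := dotL _ _ _ _ _ _ L1 L3 d13.
  have D23 := dotL _ _ _ _ _ _ L2 L3 d23.
  by move=> [[|[|[|n]]] ltn] [[|[|[|m]]] ltm] //= _; rewrite // dotC.
move=> y uy; have y0 := integer_units_neq0 uy.
have [e10 e20 e30] : [/\ e1 != 0, e2 != 0 & e3 != 0] by split; apply: integer_units_neq0.
have [k1 [k2 [k3 [n13 n23 dec]]]] := unit_square_decomp s1s s2s gen d1_gt0
  sg1s1 sg1s2 sg2s1 sg2s2 gen1 gen2 gen3 erefl h2 h3 e10 e20 e30 uy.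
(* As [e3] has norm 1, the absolute norm of [y] is 1, and [y ^ 2] is the product of the three powers
   up to sign. *)
rewrite exp1rz mul1r in dec; rewrite exp1rz in n13 n23.
have [m1 E1] := half1 k1 n13.
have [m2 E2] := half2 k2 n23.
have [m3 E3] := half3 k3 (exp1rz _ _).
exists (fun i : 'I_3 => [:: m1; m2; m3]`_i).
have : Log phi (y ^+ 2) = Log phi (e1 ^ k1 * e2 ^ k2 * e3 ^ k3).
  by case: dec => ->; rewrite ?LogN.
rewrite LogX // !LogM ?mulf_neq0 ?expfz_neq0 // !LogXz // E1 E2 E3 -!mulrnDl.
have two_inj (v w : 'rV[R]_(\dim {:K})) : v *+ 2 = w *+ 2 -> v = w.
  by rewrite -[v *+ 2]scaler_nat -[w *+ 2]scaler_nat; apply: scalerI; rewrite pnatr_eq0.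
move/two_inj ->.
by rewrite !big_ord_recl big_ord0 addr0 addrA.
Qed.

End Criterion.

(** * Divisors and unit norms for the two cases of the theorem *)

Lemma dvdn_prime_mul (p q g : nat) : prime p -> prime q -> (g %| p * q)%N ->
  [\/ g = 1, g = p, g = q | g = p * q]%N.
Proof.
move=> pp pq gd.
have aux h r : prime r -> (h %| r)%N -> h = 1%N \/ h = r.
  by move=> /primeP[_ H] /H/orP[]/eqP; [left|right].
have [/dvdnP[h Eh]|pg] := boolP (p %| g)%N.
  have : (h %| q)%N by rewrite -(dvdn_pmul2r (prime_gt0 pp)) -Eh mulnC.
  case/(aux _ _ pq) => Eh'; rewrite Eh Eh'; first by rewrite mul1n; constructor 2.
  by rewrite mulnC; constructor 4.
have : (g %| q)%N by rewrite -(@Gauss_dvdr _ p) // coprime_sym prime_coprime.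
by case/(aux _ _ pq) => ->; [constructor 1|constructor 3].
Qed.

(** The unit [1 + s] has norm -1, which is impossible for a power of a norm 1 unit up to sign. *)
Lemma neg_unit_norm_generator_sqrt2 (K : fieldExtType rat) (s e : K)
    (sigma : {rmorphism K -> K}) :
  s ^+ 2 = 2%:R -> sigma s = - s -> e \in <<1; s>>%VS -> integer_units e ->
  (forall z, integer_units z -> z \in <<1; s>>%VS ->
    exists k : int, z = e ^ k \/ z = - e ^ k) ->
  e * sigma e = -1.
Proof.
move=> ss sigs eE ue gen.
have [n1|//] := quadratic_unit_norm ss sigs eE ue.
have si : ring_of_integers s.
  apply: ring_of_integers_sqrt; rewrite ss.
  exact: (@integral_nat _ _ (intr : {rmorphism int -> K})).
have i1 : ring_of_integers (1 : K).
  exact: (@integral1 _ _ (intr : {rmorphism int -> K})).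
have u1s : integer_units (1 + s).
  split; first exact: ring_of_integersD.
  exists (s - 1); last by ring: ss.
  by apply: ring_of_integersD => //; apply: ring_of_integersN.
have sE : 1 + s \in <<1; s>>%AS by rewrite rpredD ?rpred1 ?memv_adjoin.
have [k Ek] := gen _ u1s sE.
have : (1 + s) * sigma (1 + s) = -1 by rewrite rmorphD rmorph1 sigs; ring: ss.
suff -> : (1 + s) * sigma (1 + s) = 1.
  by move/eqP; rewrite (negPf (oppr_neq _)) ?oner_eq0.
have nk : e ^ k * sigma (e ^ k) = 1 by rewrite fmorphXz -expfzMl n1 exp1rz.
by case: Ek => ->; rewrite ?rmorphN ?mulrNN.
Qed.

(** Norm -1 would give integers with [m ^ 2 + 4 = 2 * p * u ^ 2], excluded modulo powers of 2. *)
Lemma unit_norm_neg1_excluded (K : fieldExtType rat) (s e : K) (p : nat)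
    (sigma : {rmorphism K -> K}) :
  (p %% 4 = 3)%N -> squarefree (2 * p) -> s ^+ 2 = (2 * p)%:R -> sigma s = - s ->
  e \in <<1; s>>%VS -> integer_units e -> e * sigma e = 1.
Proof.
move=> p4 sd ss sigs eE ue.
have [//|n1] := quadratic_unit_norm ss sigs eE ue.
have [m [u [_ E]]] := @trace_norm_coord _ _ _ _ sigma (-1) sd ss sigs eE (proj1 ue) n1.
case: (@sum_square4_neq p `|m| `|u| p4).
apply/eqP; rewrite -eqz_nat PoszD PoszM -!abszX !gez0_abs ?sqr_ge0 //.
by rewrite E natz; apply/eqP; ring.
Qed.

Theorem theorem1p1 (R : realType) (p1 p2 : nat)
  (p1_prime : prime p1) (p2_prime : prime p2) (p1_neq_p2 : p1 <> p2)
  (K : splittingFieldType rat) (s1 s2 : K)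
  (s1_sqr : s1 ^+ 2 = p1%:R) (s2_sqr : s2 ^+ 2 = p2%:R)
  (K_gen : <<<<1; s1>>; s2>>%VS = {:K}%VS)
  (phi : real_embeddings R K)
  (phi1 : real_embeddings R (subvs_of (rat_adjoin s1)))
  (phi2 : real_embeddings R (subvs_of (rat_adjoin s2)))
  (phi3 : real_embeddings R (subvs_of (rat_adjoin (s1 * s2))))
  (eps1 : subvs_of (rat_adjoin s1))
  (eps2 : subvs_of (rat_adjoin s2))
  (eps3 : subvs_of (rat_adjoin (s1 * s2)))
  (eps1_fund : fundamental_unit phi1 eps1)
  (eps2_fund : fundamental_unit phi2 eps2)
  (eps3_fund : fundamental_unit phi3 eps3)
  (hyp : [/\ p1 = 1 %[mod 4], p2 <> 3 %[mod 4],
             norm_rat eps1 = -1, norm_rat eps2 = -1 & norm_rat eps3 = 1]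
         \/ (p1 = 3 %[mod 4] /\ p2 = 2%N)) :
  orthogonal_lattice (log_unit_lattice phi).
Proof.
have sf1 := squarefree_prime p1_prime; have sf2 := squarefree_prime p2_prime.
have sf3 := squarefree_prime2 p1_prime p2_prime p1_neq_p2.
have p1_1 : p1 != 1%N by rewrite gtn_eqF ?prime_gt1.
have p2_1 : p2 != 1%N by rewrite gtn_eqF ?prime_gt1.
have p3_1 : (p1 * p2 != 1)%N by rewrite muln_eq1 negb_and p1_1.
have s3_sqr : (s1 * s2) ^+ 2 = (p1 * p2)%:R by rewrite exprMn s1_sqr s2_sqr natrM.
have rat_sqr (s : K) d : s ^+ 2 = d%:R -> s ^+ 2 \in (1%VS : {vspace K}).
  by move=> ->; rewrite (@rpred_nat _ 1%AS).
have n1 : s1 \notin 1%VS := sqrt_notin_rat sf1 p1_1 s1_sqr.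
have n2 : s2 \notin 1%VS := sqrt_notin_rat sf2 p2_1 s2_sqr.
have n3 : s1 * s2 \notin 1%VS := sqrt_notin_rat sf3 p3_1 s3_sqr.
have n12 : s2 \notin <<1; s1>>%AS by apply: (sqrt_notin_quadratic s1_sqr s2_sqr).
have n21 : s1 \notin <<1; s2>>%AS.
  by apply: (sqrt_notin_quadratic s2_sqr s1_sqr); rewrite // mulnC.
have s2_sqr1 : s2 ^+ 2 \in <<1; s1>>%AS by rewrite s2_sqr rpred_nat.
have s1_sqr2 : s1 ^+ 2 \in <<1; s2>>%AS by rewrite s1_sqr rpred_nat.
have K_gen' : <<<<1; s2>>; s1>>%VS = {:K}%VS by rewrite adjoinC.
have dimK : \dim {:K} = 4%N.
  rewrite -K_gen (dim_quadratic_adjoin s2_sqr1 n12).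
  by rewrite (@dim_quadratic_adjoin _ _ 1%AS _ (rat_sqr _ _ s1_sqr) n1) dimv1.
have [sg1 [sg1s2 sg1E [f1 f1E f1hom]]] := quadratic_conj s2_sqr1 n12 K_gen.
have [sg2 [sg2s1 sg2E [f2 f2E f2hom]]] := quadratic_conj s1_sqr2 n21 K_gen'.
have sg1s1 : sg1 s1 = s1 by apply/sg1E/memv_adjoin.
have sg2s2 : sg2 s2 = s2 by apply/sg2E/memv_adjoin.
have sg1s3 : sg1 (s1 * s2) = - (s1 * s2) by rewrite rmorphM sg1s1 sg1s2 mulrN.
have s_opp s : s \notin (1%VS : {vspace K}) -> s != - s.
  by move=> sn; apply: oppr_neq; apply: contraNneq sn => ->; apply: mem0v.
have norm1 : norm_rat eps1 = vsval eps1 * sg2 (vsval eps1).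
  rewrite f2E; apply: (galNorm_quadratic (rat_sqr _ _ s1_sqr) n1 (s_opp _ n1) f2hom).
    by rewrite -f2E.
  exact: subvsP.
have norm2 : norm_rat eps2 = vsval eps2 * sg1 (vsval eps2).
  rewrite f1E; apply: (galNorm_quadratic (rat_sqr _ _ s2_sqr) n2 (s_opp _ n2) f1hom).
    by rewrite -f1E.
  exact: subvsP.
have norm3 : norm_rat eps3 = vsval eps3 * sg1 (vsval eps3).
  rewrite f1E; apply: (galNorm_quadratic (rat_sqr _ _ s3_sqr) n3 (s_opp _ n3) f1hom).
    by rewrite -f1E.
  exact: subvsP.
have unit_val (s : K) (psi : real_embeddings R (subvs_of (rat_adjoin s))) e :
    fundamental_unit psi e -> integer_units (vsval e).
  by case=> ue _; apply: (integer_units_morph (vsval : {rmorphism _ -> K}) ue).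
have ue1 := unit_val _ _ _ eps1_fund; have ue2 := unit_val _ _ _ eps2_fund.
have ue3 := unit_val _ _ _ eps3_fund.
have gen1 z uz zE := @subfield_fundamental_unit_generates _ _ _ _ _ z eps1_fund uz zE.
have gen2 z uz zE := @subfield_fundamental_unit_generates _ _ _ _ _ z eps2_fund uz zE.
have gen3 z uz zE := @subfield_fundamental_unit_generates _ _ _ _ _ z eps3_fund uz zE.
have e1E : vsval eps1 \in <<1; s1>>%VS := subvsP eps1.
have e2E : vsval eps2 \in <<1; s2>>%VS := subvsP eps2.
have e3E : vsval eps3 \in <<1; s1 * s2>>%VS := subvsP eps3.
have dim_gt0 : (0 < \dim {:K})%N by rewrite dimK.
(* This makes [D = p1 * p2] admissible whenever [unit_norm1_sqrt] is applied. *)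
have sqrt_dvd g : (g %| p1 * p2)%N -> exists r : K, r ^+ 2 = g%:R.
  case/(@dvdn_prime_mul _ _ g p1_prime p2_prime) => ->; last by exists (s1 * s2).
  - by exists 1; rewrite expr1n.
  - by exists s1.
  - by exists s2.
(* The residues 0 and 3 are thus excluded, so for [d = D = p1 * p2] the requirement that [2 * d]
   divide [D] is vacuous. *)
have mod4 : (((p1 * p2) %% 4 == 1) || ((p1 * p2) %% 4 == 2))%N.
  case: hyp => [[p1m p2m _ _ _]|[p1m ->]]; last by rewrite -modnMm p1m.
  rewrite -modnMm p1m; have := ltn_pmod p2 (isT : 0 < 4)%N; move: p2m.
  have : (p2 %% 4 != 0)%N.
    apply/negP => p2_4; have := dvdn_trans (isT : 2 %| 4)%N p2_4.
    by rewrite dvdn_prime2 // => /eqP p2E; move: p2_4; rewrite -p2E.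
  by case: (p2 %% 4)%N => [|[|[|[|]]]].
pose psi := phi (Ordinal dim_gt0).
have h4 : vsval eps3 * sg1 (vsval eps3) = 1 ->
    exists u, u ^+ 2 = vsval eps3 \/ u ^+ 2 = - vsval eps3.
  apply: (@unit_norm1_sqrt _ _ psi _ _ _ (p1 * p2) sg1 sf3 _ _ _ sqrt_dvd
    s3_sqr sg1s3 e3E (proj1 ue3)) => //.
    by case/orP: mod4 => /eqP ->.
  by case/orP: mod4 => /eqP ->.
have [h1 h2 h3] : [/\ vsval eps1 * sg2 (vsval eps1) = -1 \/
     (exists u, u ^+ 2 = vsval eps1 \/ u ^+ 2 = - vsval eps1),
    vsval eps2 * sg1 (vsval eps2) = -1 & vsval eps3 * sg1 (vsval eps3) = 1].
  case: hyp => [[_ _ N1 N2 N3]|[p1m p2E]].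
    by rewrite -norm1 -norm2 -norm3; split=> //; left.
  (* For the first unit [d = p1] is 3 modulo 4, and the required divisibility of [D] by [2 * d] is
     the equality [D = 2 * p1]. *)
  have p3E : (p1 * p2 = 2 * p1)%N by rewrite p2E mulnC.
  split.
  - have [n1_1|] := quadratic_unit_norm s1_sqr sg2s1 e1E ue1; last by left.
    right; apply: (@unit_norm1_sqrt _ _ psi _ _ _ (p1 * p2) sg2 sf1 _ _ _ sqrt_dvd
      s1_sqr sg2s1 e1E (proj1 ue1)) => //.
    + by rewrite p1m.
    + exact: dvdn_mulr.
    + by rewrite p3E.
  - move: s2_sqr; rewrite p2E => s2_sqr'.
    exact: (neg_unit_norm_generator_sqrt2 s2_sqr' sg1s2 e2E ue2 gen2).
  - rewrite p3E in sf3 s3_sqr.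
    exact: (unit_norm_neg1_excluded p1m sf3 s3_sqr sg1s3 e3E ue3).
apply: (orthogonal_criterion s1_sqr s2_sqr K_gen dimK (prime_gt0 p1_prime)
  sg1s1 sg1s2 sg2s1 sg2s2 e1E e2E e3E ue1 ue2 ue3
  (subfield_fundamental_unit_Log phi eps1_fund)
  (subfield_fundamental_unit_Log phi eps2_fund)
  (subfield_fundamental_unit_Log phi eps3_fund) gen1 gen2 gen3) => //.
exact: h4.
Qed.
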